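(* Let $f_t\in\mathcal{S}^{2,1}_{\mu_t,L_t}(\mathbb{R}^n\times\mathbb{R}^n)$ for all $t\ge 1$, with $0<\mu_{\min}\le\mu_t\le L_t\le L_{\max}<\infty$ for all $t\ge1$. Let $$\kappa:=\frac{2L_{\max}+\mu_{\min}}{2},\qquad \delta:=\frac{2L_{\max}-\mu_{\min}}{2L_{\max}+\mu_{\min}},$$ and suppose that for a constant $\theta>0$ the off-diagonal Hessian blocks satisfy $\|\mathbf{E}_t(\underline{\mathbf{x}})\|\le\kappa\theta$ for all $t\ge0$ and all arguments $\underline{\mathbf{x}}$. Suppose that $\theta<(1-\delta)/2$ and that there is a constant $M_x$ such that the isolated minimizers satisfy $$\left\|\begin{bmatrix}\bar{\mathbf{x}}_{t-1|t}\\ \bar{\mathbf{x}}_{t|t}\end{bmatrix}\right\|\le M_x\qquad\text{for all } t\ge 1.$$ Then, for some $\epsilon_*$ and $\rho$ with $\rho=\theta/(1-\epsilon_* )<1$ (and $\epsilon_*<1$), the minimizers $\{\hat{\mathbf{x}}_{t|T}\}_{t=0}^T$ of $J_T$ are bounded, for all $T\ge1$ and $0\le t\le T$, as $$\|\hat{\mathbf{x}}_{t|T}\|\le M_g\,\frac{1-\rho^{T-t+1}}{(1-\epsilon_* )(1-\rho)^2},\qquad\text{where } M_g=2M_x\kappa\sqrt{L_{\max}^2+\theta^2}.$$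
   Context: $\mathcal{S}^{2,1}_{\mu,L}(\mathcal{D})$ is the class of $\mu$-strongly convex functions on $\mathcal{D}$ with two continuous derivatives whose first derivative (gradient) is $L$-Lipschitz continuous on $\mathcal{D}$. For $T\ge1$, $J_T(\mathbf{x}_0,\dots,\mathbf{x}_T)=\sum_{t=1}^T f_t(\mathbf{x}_{t-1},\mathbf{x}_t)$ with each $\mathbf{x}_t\in\mathbb{R}^n$, and $(\hat{\mathbf{x}}_{0|T},\dots,\hat{\mathbf{x}}_{T|T})$ denotes the (unique) minimizer of $J_T$. The isolated minimizers are $(\bar{\mathbf{x}}_{t-1|t},\bar{\mathbf{x}}_{t|t}):=\arg\min_{\mathbf{x}_{t-1},\mathbf{x}_t}f_t(\mathbf{x}_{t-1},\mathbf{x}_t)$. The Hessian of $J_T$ is block tridiagonal, with off-diagonal (block position $(t+1,t)$) blocks $\mathbf{E}_t(\underline{\mathbf{x}})=\nabla_{t+1,t}f_{t+1}(\mathbf{x}_t,\mathbf{x}_{t+1})$, the $n\times n$ matrix of mixed second partial derivatives $\partial^2 f_{t+1}/\partial\mathbf{x}_{t+1}\partial\mathbf{x}_t$. $\|\cdot\|$ is the Euclidean norm for vectors and the induced operator norm for matrices. *)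

(* Defs.v *)
From mathcomp Require Import all_boot all_order all_algebra.
From mathcomp Require Import all_classical all_reals all_analysis.

Set Implicit Arguments.
Unset Strict Implicit.
Unset Printing Implicit Defensive.

Import Order.TTheory GRing.Theory Num.Theory.
Import numFieldNormedType.Exports.

Local Open Scope classical_set_scope.
Local Open Scope ring_scope.

(* R^m is 'cV[R]_m, and R^n x R^n is 'cV[R]_(n + n), a pair (x, y) being the
   stacked vector col_mx x y. The library norm `|x| on matrices is the sup norm
   (it is only used through the topology it induces), hence enorm. *)
Definition enorm {R : realType} {m : nat} (v : 'cV[R]_m) : R :=
  Num.sqrt (\sum_(i < m) v i ord0 ^+ 2).

Definition opnorm {R : realType} {p q : nat} (A : 'M[R]_(p, q)) : R :=
  sup [set enorm (A *m v) | v in [set v : 'cV[R]_q | enorm v <= 1]].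

Definition basis_vec {R : realType} {m : nat} (i : 'I_m) : 'cV[R]_m :=
  delta_mx i ord0.

Definition partial {R : realType} {m : nat} (i : 'I_m) (f : 'cV[R]_m -> R)
  : 'cV[R]_m -> R := fun x => 'D_(basis_vec i) f x.

Definition gradient {R : realType} {m : nat} (f : 'cV[R]_m -> R)
  (x : 'cV[R]_m) : 'cV[R]_m := \col_i partial i f x.

Definition hessian {R : realType} {m : nat} (f : 'cV[R]_m -> R)
  (x : 'cV[R]_m) : 'M[R]_m := \matrix_(i, j) partial i (partial j f) x.

(* Differentiability (Frechet) is required separately because partial is a
   total function, with an arbitrary value where the derivative fails to
   exist. *)
Definition twice_continuously_differentiable {R : realType} {m : nat}
  (f : 'cV[R]_m -> R) : Prop :=
  [/\ forall x, differentiable f x,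
      forall i x, differentiable (partial i f) x
    & forall i j, continuous (partial i (partial j f))].

Definition strongly_convex {R : realType} {m : nat} (mu : R)
  (f : 'cV[R]_m -> R) : Prop :=
  forall (x y : 'cV[R]_m) (s : R), 0 <= s <= 1 ->
    f (s *: x + (1 - s) *: y)
      <= s * f x + (1 - s) * f y - mu / 2 * (s * (1 - s)) * enorm (x - y) ^+ 2.

Definition lipschitz_gradient {R : realType} {m : nat} (L : R)
  (f : 'cV[R]_m -> R) : Prop :=
  forall x y : 'cV[R]_m,
    enorm (gradient f x - gradient f y) <= L * enorm (x - y).

(* The class S^{2,1}_{mu,L} on the whole space R^m. *)
Definition class_S21 {R : realType} {m : nat} (mu L : R)
  (f : 'cV[R]_m -> R) : Prop :=
  [/\ strongly_convex mu f, twice_continuously_differentiable f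
    & lipschitz_gradient L f].

Definition is_minimizer {R : realType} {X : Type} (F : X -> R) (x : X) : Prop :=
  forall y : X, F x <= F y.

(* The summand of index s : 'I_T is f_{s+1}(x_s, x_{s+1}), so that the functions
   that occur are f_1, ..., f_T; f 0 is never used. *)
Definition J {R : realType} {n : nat} (f : nat -> 'cV[R]_(n + n) -> R) (T : nat)
  (x : 'I_T.+1 -> 'cV[R]_n) : R :=
  \sum_(s < T) f s.+1 (col_mx (x (inord s)) (x (inord s.+1))).

(* The block of second derivatives of f_{t+1}(x_t, x_{t+1}) with rows indexed by
   x_{t+1} and columns by x_t. *)
Definition E_block {R : realType} {n : nat} (f : nat -> 'cV[R]_(n + n) -> R)
  (t : nat) (z : 'cV[R]_(n + n)) : 'M[R]_n :=
  dlsubmx (hessian (f t.+1) z).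

(* Main.v *)
Require Import Defs.
From mathcomp Require Import all_boot all_order all_algebra.
From mathcomp Require Import all_classical all_reals all_analysis.
From mathcomp Require Import ring lra.

Import Order.TTheory GRing.Theory Num.Theory.
Import numFieldNormedType.Exports.

Local Open Scope ring_scope.

(** Let m be the largest norm of a block of the minimizer of J_T, attained at
    time t.  Replacing that block by 0 raises J_T by at least mu_min/2 m^2 for
    each of the (one or two) summands that contain it, by strong convexity.  On
    the other hand h(0,b) - h(a,b) is h(0,0) - h(a,0), which is at most
    L_max M_x^2, minus a mixed second difference, which is at most
    kappa theta |a| |b|.  The condition on theta says exactly that
    2 kappa theta < mu_min, so m <= Q M_x with Q independent of T and t.
    Since 1 - rho^(T-t+1) >= 1 - rho, the right-hand side of the claim is at
    least M_g rho / (theta (1 - rho)), and rho can be taken so close to 1 that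
    this exceeds Q M_x. *)

(** * Euclidean norm, Cauchy-Schwarz and the operator norm *)

Lemma enorm_ge0 (R : realType) (m : nat) (v : 'cV[R]_m) : 0 <= enorm v.
Proof. exact: sqrtr_ge0. Qed.

Lemma sqr_enorm (R : realType) (m : nat) (v : 'cV[R]_m) :
  enorm v ^+ 2 = \sum_(i < m) v i ord0 ^+ 2.
Proof. by rewrite sqr_sqrtr// sumr_ge0// => i _; exact: sqr_ge0. Qed.

Lemma enorm0_entry (R : realType) (m : nat) (v : 'cV[R]_m) (i : 'I_m) :
  enorm v = 0 -> v i ord0 = 0.
Proof.
move=> v0; have := sqr_enorm R m v; rewrite v0 expr0n/= => /esym/eqP.
rewrite psumr_eq0 => [/allP/(_ i (mem_index_enum _))|j _]; last exact: sqr_ge0.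
by rewrite sqrf_eq0 => /eqP.
Qed.

Lemma enormZ (R : realType) (m : nat) (c : R) (v : 'cV[R]_m) :
  enorm (c *: v) = `|c| * enorm v.
Proof.
rewrite /enorm -sqrtr_sqr -sqrtrM ?sqr_ge0// mulr_sumr; congr Num.sqrt.
by apply: eq_bigr => i _; rewrite mxE exprMn.
Qed.

Lemma enormN (R : realType) (m : nat) (v : 'cV[R]_m) : enorm (- v) = enorm v.
Proof. by rewrite -scaleN1r enormZ normrN1 mul1r. Qed.

Lemma sqr_enorm_col_mx (R : realType) (m p : nat) (a : 'cV[R]_m) (b : 'cV[R]_p) :
  enorm (col_mx a b) ^+ 2 = enorm a ^+ 2 + enorm b ^+ 2.
Proof.
rewrite !sqr_enorm big_split_ord/=; congr (_ + _); apply: eq_bigr => i _.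
  by rewrite col_mxEu.
by rewrite col_mxEd.
Qed.

(** Cauchy-Schwarz: with [a] and [b] the two norms, the squared norm of [b u - a v] expands to
    [2 a b (a b - S)], [S] being the inner product. Cancelling [a b] requires both norms to be
    nonzero, hence the separate zero cases. *)
Lemma dot_le_enorm (R : realType) (m : nat) (u v : 'cV[R]_m) :
  \sum_(i < m) u i ord0 * v i ord0 <= enorm u * enorm v.
Proof.
set a := enorm u; set b := enorm v.
have a0 : 0 <= a by exact: enorm_ge0.
have b0 : 0 <= b by exact: enorm_ge0.
have [ua|ua] := eqVneq a 0.
  by rewrite ua mul0r big1// => i _; rewrite (enorm0_entry R m u)// mul0r.
have [vb|vb] := eqVneq b 0.
  by rewrite vb mulr0 big1// => i _; rewrite (enorm0_entry R m v)// mulr0.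
have ab0 : 0 < a * b by rewrite mulr_gt0// lt_def ?ua ?vb.
have : 0 <= \sum_(i < m) (b * u i ord0 - a * v i ord0) ^+ 2.
  by apply: sumr_ge0 => i _; exact: sqr_ge0.
have -> : \sum_(i < m) (b * u i ord0 - a * v i ord0) ^+ 2 =
    b ^+ 2 * a ^+ 2 + a ^+ 2 * b ^+ 2
    - 2 * (a * b) * \sum_(i < m) u i ord0 * v i ord0.
  transitivity (b ^+ 2 * (\sum_(i < m) u i ord0 ^+ 2)
      + a ^+ 2 * (\sum_(i < m) v i ord0 ^+ 2)
      - 2 * (a * b) * \sum_(i < m) u i ord0 * v i ord0); last first.
    by rewrite -!sqr_enorm.
  rewrite !mulr_sumr -big_split/= -sumrB; apply: eq_bigr => i _; ring.
set S := \sum_(_ < _) _ => H.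
have : 0 <= (a * b) * (a * b - S) by nra.
by rewrite pmulr_rge0// subr_ge0.
Qed.

Lemma norm_dot_le_enorm (R : realType) (m : nat) (u v : 'cV[R]_m) :
  `|\sum_(i < m) u i ord0 * v i ord0| <= enorm u * enorm v.
Proof.
rewrite ler_norml dot_le_enorm andbT lerNl -sumrN -(enormN R m u).
apply: le_trans (dot_le_enorm _ _ _ _); rewrite le_eqVlt; apply/orP; left.
by apply/eqP; apply: eq_bigr => i _; rewrite mxE mulNr.
Qed.

Lemma enorm_mulmx_le_opnorm (R : realType) (p q : nat) (A : 'M[R]_(p, q))
  (v : 'cV[R]_q) : enorm (A *m v) <= opnorm A * enorm v.
Proof.
set S := [set enorm (A *m w) | w in [set w : 'cV[R]_q | enorm w <= 1]]%classic.
have entry_le (w : 'cV[R]_q) (j : 'I_q) : enorm w <= 1 -> `|w j ord0| <= 1.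
  move=> w1; apply: le_trans w1; rewrite -sqrtr_sqr ler_wsqrtr//.
  by rewrite (bigD1 j)//= lerDl sumr_ge0// => i _; exact: sqr_ge0.
(* The supremum in [opnorm] is informative only for a set bounded above. Entries of a vector in the
   unit ball are at most 1 in absolute value, so absolute row sums of [A] give a bound. *)
have ubS : has_ubound S.
  exists (Num.sqrt (\sum_(i < p) (\sum_(j < q) `|A i j|) ^+ 2)) => _ [w w1 <-].
  apply: ler_wsqrtr; apply: ler_sum => i _; rewrite -real_normK ?num_real//.
  apply: lerXn2r; rewrite ?nnegrE ?sumr_ge0// mxE.
  apply: le_trans (ler_norm_sum _ _ _) _; apply: ler_sum => j _.
  by rewrite normrM ler_piMr// entry_le.
have [v0|v0] := eqVneq (enorm v) 0.
  suff -> : v = 0.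
    by rewrite mulmx0 /enorm !big1 ?sqrtr0 ?mulr0// => i _; rewrite mxE expr0n.
  by apply/matrixP => i j; rewrite (ord1 j) mxE (enorm0_entry R q v).
have vgt0 : 0 < enorm v by rewrite lt_def v0 enorm_ge0.
rewrite -ler_pdivrMr//.
have -> : enorm (A *m v) / enorm v = enorm (A *m ((enorm v)^-1 *: v)).
  by rewrite -scalemxAr enormZ ger0_norm ?invr_ge0 ?enorm_ge0// mulrC.
apply: (ub_le_sup ubS); exists ((enorm v)^-1 *: v) => //=.
by rewrite enormZ ger0_norm ?invr_ge0 ?enorm_ge0// mulVf.
Qed.

(** * First and second order estimates along lines *)

Lemma is_derive_line (R : realType) (m : nat) (h : 'cV[R]_m -> R)
  (x v : 'cV[R]_m) (r : R) : differentiable h (x + r *: v) ->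
  is_derive r 1 (fun s => h (x + s *: v)) ('D_v h (x + r *: v)).
Proof.
move=> dh; have hv : derivable h (x + r *: v) v by exact: diff_derivable.
have E : (fun d : R => d^-1 *: (((fun s => h (x + s *: v)) \o shift r) (d *: 1)
     - h (x + r *: v))) =
   (fun d : R => d^-1 *: ((h \o shift (x + r *: v)) (d *: v) - h (x + r *: v))).
  apply/funext => d /=; congr (_ *: (h _ - _)).
  by rewrite [d *: 1]mulr1 scalerDl addrCA.
by split; rewrite /derivable /derive E.
Qed.

Lemma MVT_unit (R : realType) (g dg : R -> R) :
  (forall s : R, is_derive s 1 g (dg s)) ->
  exists2 c : R, 0 <= c <= 1 & g 1 - g 0 = dg c.
Proof.
move=> dgP.
have cg : ({within `[0, 1], continuous g})%classic.
  apply: continuous_subspaceT => s; apply: differentiable_continuous.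
  by apply/derivable1_diffP; have [] := dgP s.
have [c c01] := MVT_segment ler01 (fun s _ => dgP s) cg.
by rewrite subr0 mulr1; exists c.
Qed.

Lemma line_MVT (R : realType) (m : nat) (h : 'cV[R]_m -> R) (x v : 'cV[R]_m) :
  (forall y, differentiable h y) ->
  exists2 c : R, 0 <= c <= 1 & h (x + v) - h x = 'D_v h (x + c *: v).
Proof.
move=> dh.
have [c c01] := MVT_unit R _ _ (fun s => is_derive_line R m h x v s (dh _)).
by rewrite scale1r scale0r addr0; exists c.
Qed.

Lemma derive_partial (R : realType) (m : nat) (h : 'cV[R]_m -> R)
  (x v : 'cV[R]_m) : differentiable h x ->
  'D_v h x = \sum_(i < m) v i ord0 * partial i h x.
Proof.
move=> dh; rewrite deriveE//.
have {1}-> : v = \sum_(i < m) v i ord0 *: basis_vec i.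
  apply/matrixP => i j; rewrite (ord1 j) summxE (bigD1 i)//= big1 => [|k ki].
    by rewrite !mxE !eqxx mulr1 addr0.
  by rewrite !mxE eq_sym (negbTE ki) mulr0.
rewrite linear_sum; apply: eq_bigr => i _.
by rewrite linearZ/= /partial deriveE.
Qed.

(** Fermat's rule on the coordinate line through [x], where [s = 0] is an interior minimum of [g] on
    (-1, 1). *)
Lemma partial_minimizer (R : realType) (m : nat) (h : 'cV[R]_m -> R)
  (x : 'cV[R]_m) (i : 'I_m) :
  (forall y, differentiable h y) -> is_minimizer h x -> partial i h x = 0.
Proof.
move=> dh hx; set g := fun s : R => h (x + s *: basis_vec i).
have dg (s : R) : is_derive s 1 g ('D_(basis_vec i) h (x + s *: basis_vec i)).
  exact: is_derive_line.
have : is_derive (0 : R) 1 g 0.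
  apply: (@derive1_at_min R g (-1) 1 0).
  - by rewrite lerNl; lra.
  - by move=> s _; have [] := dg s.
  - by rewrite in_itv/=; lra.
  - by move=> s _; rewrite /g scale0r addr0.
case=> _; have [_ ->] := dg 0.
by rewrite scale0r addr0.
Qed.

(** By the mean value theorem the increment is the inner product of [y - x] with the gradient at a
    point [z] of the segment. The gradient vanishes at [x], so its norm at [z] is at most [L] times
    the distance from [x] to [z]. *)
Lemma sub_minimizer_le (R : realType) (m : nat) (L : R) (h : 'cV[R]_m -> R)
  (x y : 'cV[R]_m) :
  0 <= L -> (forall z, differentiable h z) -> lipschitz_gradient L h ->
  is_minimizer h x -> h y - h x <= L * enorm (y - x) ^+ 2.
Proof.
move=> L0 dh lip hx.
have [c /andP[c0 c1]] := line_MVT R m h x (y - x) dh.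
have -> : x + (y - x) = y by rewrite addrC subrK.
move=> ->; rewrite derive_partial//.
have gx : gradient h x = 0.
  by apply/matrixP => i j; rewrite !mxE partial_minimizer.
set z := x + _.
have -> : \sum_(i < m) (y - x) i ord0 * partial i h z
   = \sum_(i < m) (y - x) i ord0 * gradient h z i ord0.
  by apply: eq_bigr => i _; rewrite [gradient _ _ _ _]mxE.
apply: le_trans (dot_le_enorm _ _ _ _) _.
rewrite expr2 mulrCA ler_wpM2l ?enorm_ge0//.
have := lip z x; rewrite gx subr0 => /le_trans; apply.
rewrite ler_wpM2l// /z addrAC subrr add0r enormZ ger0_norm//.
by rewrite ler_piMl ?enorm_ge0.
Qed.

(** Two applications of the mean value theorem, first along [(a, 0)] and then along [(0, b)], turn
    the mixed difference into the inner product of [b] with [E a], where [E] is the lower left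
    Hessian block at an intermediate point. *)
Lemma mixed_difference_le (R : realType) (n : nat) (K : R)
  (h : 'cV[R]_(n + n) -> R) (a b : 'cV[R]_n) :
  twice_continuously_differentiable h ->
  (forall z, opnorm (dlsubmx (hessian h z)) <= K) ->
  `|h (col_mx a b) - h (col_mx a 0) - (h (col_mx 0 b) - h 0)|
    <= K * enorm a * enorm b.
Proof.
move=> [dh dph _] hK.
set v := col_mx a (0 : 'cV[R]_n); set w := col_mx (0 : 'cV[R]_n) b.
have -> : col_mx a b = w + v by rewrite add_col_mx addr0 add0r.
have [c _] := MVT_unit R _ _ (fun s => is_deriveB
  (is_derive_line R _ h w v s (dh _)) (is_derive_line R _ h 0 v s (dh _))).
rewrite !fctE !scale1r !scale0r !addr0 !add0r => ->.
(* Writing the derivative along [v] as a combination of partials makes it differentiable, which the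
   second mean value step needs. *)
pose k i := v i ord0 \*: partial i h.
have kE y : 'D_v h y = (\sum_i k i) y.
  by rewrite derive_partial// fct_sumE.
have dk y : differentiable (\sum_i k i) y.
  by apply: differentiable_sum => i; exact: differentiableZ.
have [d _] := line_MVT R _ (\sum_i k i) (c *: v) w dk.
set y := _ + d *: w.
rewrite !kE [w + _]addrC => ->.
rewrite derive_sum => [|i]; last by apply/derivableZ/diff_derivable.
(* Only the lower half of [w] and the upper half of [v] are nonzero, so of the four Hessian blocks
   only the lower left one survives. *)
have -> : \sum_i 'D_w (k i) y = \sum_j b j ord0 *
    (dlsubmx (hessian h y) *m a) j ord0.
  transitivity (\sum_(i < n + n) \sum_(j < n + n)
      w j ord0 * (hessian h y j i * v i ord0)).
    apply: eq_bigr => i _; rewrite deriveZ; last exact: diff_derivable.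
    rewrite derive_partial// [LHS]mulr_sumr; apply: eq_bigr => j _.
    by rewrite [hessian _ _ _ _]mxE mulrC mulrA.
  rewrite exchange_big/= big_split_ord/= big1 => [|j _]; last first.
    by apply: big1 => i _; rewrite col_mxEu mxE mul0r.
  rewrite add0r; apply: eq_bigr => j _; rewrite col_mxEd -mulr_sumr mxE.
  congr (_ * _); rewrite big_split_ord/= [X in _ + X]big1 => [|i _].
    rewrite addr0; apply: eq_bigr => i _.
    by rewrite col_mxEu [dlsubmx _ _ _]mxE [dsubmx _ _ _]mxE.
  by rewrite col_mxEd [X in _ * X]mxE mulr0.
apply: le_trans (norm_dot_le_enorm _ _ _ _) _.
rewrite mulrC ler_wpM2r ?enorm_ge0//.
apply: le_trans (enorm_mulmx_le_opnorm _ _ _ _ _) _.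
by rewrite ler_wpM2r ?enorm_ge0.
Qed.

(** * Quadratic growth of [J] at its minimizer and the uniform bound on its blocks *)

Lemma J_minimizer_growth (R : realType) (n : nat) (mu : R)
  (f : nat -> 'cV[R]_(n + n) -> R) (T : nat) (x y : 'I_T.+1 -> 'cV[R]_n) :
  0 < mu -> (forall s, strongly_convex mu (f s.+1)) ->
  is_minimizer (@J R n f T) x ->
  mu / 2 * \sum_(s < T) enorm (col_mx (y (inord s)) (y (inord s.+1))
                             - col_mx (x (inord s)) (x (inord s.+1))) ^+ 2
    <= @J R n f T y - @J R n f T x.
Proof.
move=> mu0 fcvx xmin; set D := \sum_(s < T) _.
have D0 : 0 <= D by apply: sumr_ge0 => s _; exact: sqr_ge0.
(* Strong convexity of each summand at the point [r y + (1 - r) x], summed over the summands;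
   minimality of [x] bounds [J] there from below, and a factor [r] cancels. *)
have gap r : 0 < r -> r <= 1 -> (1 - r) * (mu / 2 * D) <= J f y - J f x.
  move=> r0 r1; rewrite -(ler_pM2l r0).
  have := xmin (fun s => r *: y s + (1 - r) *: x s).
  suff : J f (fun s => r *: y s + (1 - r) *: x s)
      <= r * J f y + (1 - r) * J f x - mu / 2 * (r * (1 - r)) * D by nra.
  rewrite /J /D !mulr_sumr -big_split/= -sumrB; apply: ler_sum => s _.
  by rewrite -add_col_mx -!scale_col_mx fcvx// r1 ltW.
rewrite leNgt; apply/negP => lt.
set B := mu / 2 * D in gap lt *; set G := _ - _ in gap lt *.
have B0 : 0 <= B by rewrite mulr_ge0// divr_ge0// ltW.
have G0 : 0 <= G by have := gap 1 ltr01 (lexx _); rewrite subrr mul0r.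
have Bp : 0 < B by exact: le_lt_trans lt.
have B2 : 0 < 2 * B by rewrite mulr_gt0.
(* In place of the limit as [r] tends to 0: for this [r], [(1 - r) * B] is the midpoint of [G] and
   [B], which exceeds [G] if [G < B]. *)
have r1 : (B - G) / (2 * B) <= 1 by rewrite ler_pdivrMr//; lra.
have := gap _ (divr_gt0 (_ : 0 < B - G) B2) r1; rewrite subr_gt0 => /(_ lt).
have -> : (1 - (B - G) / (2 * B)) * B = (B + G) / 2 by field; rewrite gt_eqF.
by lra.
Qed.

Lemma zero_fst_le (R : realType) (n : nat) (K C : R)
  (h : 'cV[R]_(n + n) -> R) (a b : 'cV[R]_n) :
  twice_continuously_differentiable h ->
  (forall z, opnorm (dlsubmx (hessian h z)) <= K) ->
  (forall z, h 0 - h z <= C) ->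
  h (col_mx 0 b) - h (col_mx a b) <= K * enorm a * enorm b + C.
Proof.
move=> dh hK hC; have := mixed_difference_le _ _ _ _ a b dh hK.
by rewrite ler_norml => /andP[H _]; have := hC (col_mx a 0); lra.
Qed.

Lemma zero_snd_le (R : realType) (n : nat) (K C : R)
  (h : 'cV[R]_(n + n) -> R) (a b : 'cV[R]_n) :
  twice_continuously_differentiable h ->
  (forall z, opnorm (dlsubmx (hessian h z)) <= K) ->
  (forall z, h 0 - h z <= C) ->
  h (col_mx a 0) - h (col_mx a b) <= K * enorm a * enorm b + C.
Proof.
move=> dh hK hC; have := mixed_difference_le _ _ _ _ a b dh hK.
by rewrite ler_norml => /andP[H _]; have := hC (col_mx 0 b); lra.
Qed.

(** With [m] the largest block norm, each summand containing the maximal block contributes at least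
    [mu / 2 * m ^+ 2] to the growth and costs at most [K * m ^+ 2 + C]. Their number is a common
    factor, so it does not matter whether there are one or two. *)
Lemma J_minimizer_le (R : realType) (n : nat) (mu K C : R)
  (f : nat -> 'cV[R]_(n + n) -> R) (T : nat) (x : 'I_T.+1 -> 'cV[R]_n)
  (t : 'I_T.+1) :
  0 < mu -> 2 * K < mu -> 0 <= K ->
  (forall s, strongly_convex mu (f s.+1)) ->
  (forall s, twice_continuously_differentiable (f s.+1)) ->
  (forall s z, opnorm (E_block f s z) <= K) ->
  (forall s z, f s.+1 0 - f s.+1 z <= C) ->
  (1 <= T)%N -> is_minimizer (@J R n f T) x ->
  (mu - 2 * K) * enorm (x t) ^+ 2 <= 2 * C.
Proof.
move=> mu0 Kmu K0 fcvx df fK fC T1 xmin.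
have [t0 _ t0max] := @arg_maxP _ _ _ t xpredT (fun s => enorm (x s)) isT.
set m := enorm (x t0).
have mx s : enorm (x s) <= m by exact: t0max.
suff : (mu - 2 * K) * m ^+ 2 <= 2 * C.
  apply: le_trans; apply: ler_wpM2l; first by rewrite subr_ge0 ltW.
  by rewrite lerXn2r ?nnegrE ?enorm_ge0.
pose y s := if s == t0 then 0 else x s.
pose touched (s : 'I_T) := (inord s == t0) || (inord s.+1 == t0).
have dist2 (s : 'I_T) : touched s ->
    m ^+ 2 <= enorm (col_mx (y (inord s)) (y (inord s.+1))
                      - col_mx (x (inord s)) (x (inord s.+1))) ^+ 2.
  rewrite opp_col_mx add_col_mx sqr_enorm_col_mx => /orP[]/eqP e.
    by rewrite {1}/y e eqxx sub0r enormN lerDl sqr_ge0.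
  by rewrite {2}/y e eqxx sub0r enormN lerDr sqr_ge0.
have prod_le a b : K * enorm (x a) * enorm (x b) <= K * m ^+ 2.
  by rewrite -mulrA ler_wpM2l// expr2 ler_pM ?enorm_ge0.
have gain (s : 'I_T) :
    f s.+1 (col_mx (y (inord s)) (y (inord s.+1)))
      - f s.+1 (col_mx (x (inord s)) (x (inord s.+1)))
    <= if touched s then K * m ^+ 2 + C else 0.
  (* Both indices are at most [T], so [inord] keeps them distinct: a summand has at most one block
     replaced by 0. *)
  have neq : inord s != inord s.+1 :> 'I_T.+1.
    by rewrite -val_eqE/= !inordK ?ltnS ?(ltnW (ltn_ord s))// neq_ltn ltnSn.
  rewrite /touched; case: eqVneq => [e|ne1]/=; last case: eqVneq => [e|ne2].
  - rewrite {1}/y e eqxx /y ifN -?e 1?eq_sym//.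
    apply: le_trans (zero_fst_le _ _ _ _ _ _ _ (df s) (fK s) (fC s)) _.
    by rewrite lerD2r prod_le.
  - rewrite {2}/y e eqxx /y ifN//.
    apply: le_trans (zero_snd_le _ _ _ _ _ _ _ (df s) (fK s) (fC s)) _.
    by rewrite lerD2r prod_le.
  - by rewrite /y !ifN// subrr.
(* The block at [t0] is the first one of summand [t0] if [t0 < T], and the second one of summand
   [T - 1] if [t0 = T]. *)
have [s0 s0t] : exists s0, touched s0.
  have [tT|Tt] := ltnP t0 T.
    exists (Ordinal tT); apply/orP; left.
    by apply/eqP/val_inj; rewrite /= inordK.
  have pT : (T.-1 < T)%N by rewrite prednK.
  exists (Ordinal pT); apply/orP; right; apply/eqP/val_inj.
  by rewrite /= prednK// inordK//; apply/eqP; rewrite eqn_leq Tt -ltnS ltn_ord.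
have := J_minimizer_growth _ _ _ _ _ _ y mu0 fcvx xmin.
rewrite /J -sumrB mulr_sumr => growth.
have {growth}: \sum_(s < T | touched s) (mu / 2 * m ^+ 2 - (K * m ^+ 2 + C)) <= 0.
  rewrite sumrB subr_le0 [leRHS]big_mkcond/=.
  apply: le_trans (le_trans growth (ler_sum _ (fun s _ => gain s))).
  rewrite big_mkcond/=; apply: ler_sum => s _.
  have mu20 : 0 <= mu / 2 by rewrite divr_ge0// ltW.
  case: ifPn => [/dist2|_]; first exact: ler_wpM2l.
  by rewrite mulr_ge0// sqr_ge0.
rewrite leNgt => neg; rewrite leNgt; apply: contra neg => pos.
have c0 : 0 < mu / 2 * m ^+ 2 - (K * m ^+ 2 + C) by lra.
by rewrite (bigD1 s0)//= ltr_pwDl// sumr_ge0// => s _; exact: ltW.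
Qed.

(** * Uniform constants and the choice of [eps] and [rho] *)

Lemma strongly_convex_le (R : realType) (m : nat) (mu nu : R)
  (h : 'cV[R]_m -> R) :
  mu <= nu -> strongly_convex nu h -> strongly_convex mu h.
Proof.
move=> mn hcvx x y s s01; apply: le_trans (hcvx x y s s01) _.
rewrite lerB// -!mulrA ler_wpM2r//.
by case/andP: s01 => s0 s1; rewrite !mulr_ge0 ?invr_ge0 ?subr_ge0 ?enorm_ge0.
Qed.

Theorem theorem3 (R : realType) (n : nat)
  (f : nat -> 'cV[R]_(n + n) -> R) (mu L : nat -> R)
  (mu_min L_max kappa delta theta M_x M_g : R)
  (xbar : nat -> 'cV[R]_(n + n))
  (hmu_min : 0 < mu_min)
  (hmuL : forall t : nat, (1 <= t)%N ->
     [/\ mu_min <= mu t, mu t <= L t & L t <= L_max])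
  (hf : forall t : nat, (1 <= t)%N -> class_S21 (mu t) (L t) (f t))
  (hkappa : kappa = (2 * L_max + mu_min) / 2)
  (hdelta : delta = (2 * L_max - mu_min) / (2 * L_max + mu_min))
  (htheta : 0 < theta)
  (hE : forall (t : nat) (z : 'cV[R]_(n + n)),
     opnorm (E_block f t z) <= kappa * theta)
  (htheta_delta : theta < (1 - delta) / 2)
  (hxbar : forall t : nat, (1 <= t)%N -> is_minimizer (f t) (xbar t))
  (hM_x : forall t : nat, (1 <= t)%N -> enorm (xbar t) <= M_x)
  (hM_g : M_g = 2 * M_x * kappa * Num.sqrt (L_max ^+ 2 + theta ^+ 2)) :
  exists eps rho : R,
    [/\ eps < 1, rho = theta / (1 - eps), rho < 1
      & forall (T : nat) (xhat : 'I_T.+1 -> 'cV[R]_n), (1 <= T)%N ->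
          is_minimizer (@J R n f T) xhat ->
          forall t : 'I_T.+1,
            enorm (xhat t)
              <= M_g * ((1 - rho ^+ (T - t + 1)%N)
                          / ((1 - eps) * (1 - rho) ^+ 2))].
Proof.
have [hm0 hL0 hLm0] := hmuL 1%N isT.
have L0 : 0 < L_max by lra.
have k0 : 0 < kappa by rewrite hkappa; lra.
set K := kappa * theta.
have K0 : 0 <= K by rewrite mulr_ge0 ?ltW.
have Kmu : 2 * K < mu_min.
  have -> : mu_min = kappa * (1 - delta).
    by rewrite hkappa hdelta; field; lra.
  by rewrite /K mulrCA ltr_pM2l//; lra.
have M0 : 0 <= M_x := le_trans (enorm_ge0 _ _ _) (hM_x 1%N isT).
(* The value at [z] is at least that at [xbar s.+1], and the excess of the value at 0 over that
   minimum is controlled by the Lipschitz gradient. *)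
have C_ge s z : f s.+1 0 - f s.+1 z <= L_max * M_x ^+ 2.
  have [_ [df _ _] lf] := hf s.+1 isT.
  have [_ hmL hL] := hmuL s.+1 isT; have [hm _ _] := hmuL s.+1 isT.
  have Ls0 : 0 <= L s.+1 by lra.
  have := sub_minimizer_le _ _ _ _ _ 0 Ls0 df lf (hxbar s.+1 isT).
  rewrite sub0r enormN => fle.
  have := hxbar s.+1 isT z.
  suff : L s.+1 * enorm (xbar s.+1) ^+ 2 <= L_max * M_x ^+ 2 by lra.
  apply: ler_pM => //; first exact: sqr_ge0.
  by rewrite lerXn2r ?nnegrE ?enorm_ge0// hM_x.
pose Q := Num.sqrt (2 * L_max / (mu_min - 2 * K)).
have gap0 : 0 < mu_min - 2 * K by rewrite subr_gt0.
have xhat_le (T : nat) (xhat : 'I_T.+1 -> 'cV[R]_n) (t : 'I_T.+1) :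
    (1 <= T)%N -> is_minimizer (@J R n f T) xhat -> enorm (xhat t) <= Q * M_x.
  move=> T1 xmin.
  have : (mu_min - 2 * K) * enorm (xhat t) ^+ 2 <= 2 * (L_max * M_x ^+ 2).
    apply: (J_minimizer_le _ _ _ _ _ f) => //.
    - move=> s; have [hm _ _] := hmuL s.+1 isT; have [fc _ _] := hf s.+1 isT.
      exact: strongly_convex_le fc.
    - by move=> s; have [] := hf s.+1 isT.
  rewrite mulrC -ler_pdivlMr// => le2.
  rewrite -(@ler_pXn2r _ 2) ?nnegrE ?mulr_ge0 ?sqrtr_ge0 ?enorm_ge0//.
  rewrite exprMn [Q ^+ 2]sqr_sqrtr; last
    by rewrite divr_ge0 ?mulr_ge0 ?ltW.
  by apply: le_trans le2 _; rewrite le_eqVlt; apply/orP; left; apply/eqP; ring.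
(* [M_x] may be 0, and then so is [M_g]; the comparison therefore divides by the positive factor [g]
   of [M_g]. *)
pose g := 2 * kappa * Num.sqrt (L_max ^+ 2 + theta ^+ 2).
have g0 : 0 < g by rewrite !mulr_gt0 ?sqrtr_gt0 ?addr_gt0 ?exprn_gt0.
have Mg : M_g = M_x * g by rewrite hM_g /g; ring.
(* [q] is the value of [rho / (1 - rho)]. The lower bound [M_g * rho / (theta * (1 - rho))] of the
   claimed right-hand side is then [M_g * (Q / g + 1)], at least [Q * M_x]. *)
pose q := theta * (Q / g + 1).
have q0 : 0 < q by rewrite mulr_gt0// ltr_wpDl ?divr_ge0 ?sqrtr_ge0 ?ltW.
pose rho := q / (1 + q).
have q1 : 0 < 1 + q by lra.
have rho0 : 0 < rho by rewrite divr_gt0.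
have rho1 : rho < 1 by rewrite ltr_pdivrMr//; lra.
(* Solving [rho = theta / (1 - eps)] for [eps] forces this witness. *)
exists (1 - theta / rho), rho; rewrite opprB addrCA subrr addr0.
split => //.
- by rewrite ltrBlDr ltrDl divr_gt0.
- by field; rewrite !gt_eqF.
move=> T xhat T1 xmin t; apply: le_trans (xhat_le T xhat t T1 xmin) _.
have -> : Q * M_x = M_g * (Q / g) by rewrite Mg; field; rewrite gt_eqF.
apply: ler_wpM2l; first by rewrite Mg mulr_ge0// ltW.
apply: (@le_trans _ _ (q / theta)).
  by rewrite /q mulrAC divff ?gt_eqF// mul1r lerDl.
have -> : q / theta = (1 - rho) / (theta / rho * (1 - rho) ^+ 2).
  by rewrite /rho; field; rewrite !gt_eqF//; lra.
rewrite ler_wpM2r//.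
  by rewrite invr_ge0 mulr_ge0 ?sqr_ge0// divr_ge0 ?ltW.
(* The exponent is at least 1 even at [t = T], so the power of [rho] is at most [rho]. *)
by rewrite lerB// addn1 exprS ler_piMr ?exprn_ile1 ?ltW.
Qed.
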